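(* Let $X$ be one of the spaces $c_0(\mathbb{Z})$ or $\ell^p(\mathbb{Z})$, $1\le p<\infty$. Let $\mathcal{F}$ be a full family and let $F\subset\mathbb{N}_0$. Then $F\in\widetilde{\mathcal{F}}$ if and only if there exist an invertible $\mathcal{F}$-mixing bilateral weighted backward shift $B_w$ on $X$ and a non-empty open subset $W$ of $X$ such that \[ N_{B_w}(W,W)=F\cup\{0\}. \]
   Context: $\mathbb{N}_0$ is the set of non-negative integers; spaces are over $\mathbb{K}=\mathbb{R}$ or $\mathbb{C}$. A (Furstenberg) family is a collection $\mathcal{F}$ of subsets of $\mathbb{N}_0$ that is hereditary upward ($A\in\mathcal{F}$, $A\subset B\subset\mathbb{N}_0$ imply $B\in\mathcal{F}$), with the conventions $\mathcal{F}\ne\emptyset$ and $\emptyset\notin\mathcal{F}$. Its dual is $\mathcal{F}^*=\{A\subset\mathbb{N}_0: A\cap B\ne\emptyset \text{ for all } B\in\mathcal{F}\}$. $\mathcal{F}$ is full if $F\cap F'$ is infinite for all $F\in\mathcal{F}$, $F'\in\mathcal{F}^*$. With $F+i=\{m+i:m\in F\}$, define \[\widetilde{\mathcal{F}}=\Bigl\{F\in\mathcal{F}: \text{for every } k\in\mathbb{N}_0,\ \bigcap_{i=-k}^{k}(F+i)\cap\mathbb{N}_0\in\mathcal{F}\Bigr\}.\] For a continuous linear operator $T$ on $X$ and $U,V\subset X$, $N_T(U,V)=\{n\in\mathbb{N}_0: T^nU\cap V\ne\emptyset\}$. $T$ is $\mathcal{F}$-transitive if $N_T(U,V)\in\mathcal{F}$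 for all non-empty open $U,V\subset X$, and $\mathcal{F}$-mixing if $T\oplus T$ on $X\oplus X$ is $\mathcal{F}$-transitive. A bilateral weighted backward shift on $X$ is the operator $B_w$ given by $(B_wx)_n=w_{n+1}x_{n+1}$, $n\in\mathbb{Z}$, where $w=(w_n)_{n\in\mathbb{Z}}$ is a bounded sequence of positive reals. Invertible means bijective with continuous inverse. *)

(* Defs.v *)
From HB Require Import structures.
From mathcomp Require Import all_boot all_order all_algebra.
From mathcomp Require Import complex.
From mathcomp Require Import all_classical all_reals all_analysis.
From mathcomp Require Import ring.
Set Implicit Arguments.
Unset Strict Implicit.
Unset Printing Implicit Defensive.
Import Order.TTheory GRing.Theory Num.Theory.
Import numFieldNormedType.Exports.
Local Open Scope classical_set_scope.
Local Open Scope ring_scope.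

Definition furstenberg_family (F : set (set nat)) : Prop :=
  [/\ F !=set0, ~ F set0 & forall A B, F A -> A `<=` B -> F B].

Definition dual_family (F : set (set nat)) : set (set nat) :=
  [set A | forall B, F B -> A `&` B !=set0].

Definition full_family (F : set (set nat)) : Prop :=
  forall A B, F A -> dual_family F B -> infinite_set (A `&` B).

Definition translate (A : set nat) (i : int) : set int :=
  [set m%:Z + i | m in A].

(* The preimage under [Posz] is the intersection with the non-negative
   integers: a translate by a negative [i] may contain negative integers. *)
Definition tilde_family (F : set (set nat)) : set (set nat) :=
  [set A | F A /\ forall k : nat,
    F (Posz @^-1` \bigcap_(i in [set i : int | - k%:Z <= i <= k%:Z])
                    translate A i)].

Definition return_set (V : Type) (T : V -> V) (A B : set V) : set nat :=
  [set n | (iter n T @` A) `&` B !=set0].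

Definition family_transitive (V : topologicalType) (F : set (set nat))
    (T : V -> V) : Prop :=
  forall A B : set V, open A -> A !=set0 -> open B -> B !=set0 ->
    F (return_set T A B).

Definition direct_sum (V : Type) (T : V -> V) : V * V -> V * V :=
  fun z => (T z.1, T z.2).

Definition family_mixing (V : topologicalType) (F : set (set nat))
    (T : V -> V) : Prop :=
  family_transitive F (direct_sum T).

Definition invertible (V : topologicalType) (T : V -> V) : Prop :=
  exists S : V -> V, [/\ cancel T S, cancel S T & continuous S].

Inductive scalars := real_scalars | complex_scalars.

Definition scalar_field (R : realType) (s : scalars) : numFieldType :=
  match s with real_scalars => R | complex_scalars => R[i] end.

Definition of_real (R : realType) (s : scalars) : R -> scalar_field R s :=
  match s with
  | real_scalars => fun a => a
  | complex_scalars => fun a => a%:C%C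
  end.

(* The norm of a numFieldType takes its values in that field; real powers,
   suprema and sums are taken in R. *)
Definition modulus (R : realType) (s : scalars) : scalar_field R s -> R :=
  match s with
  | real_scalars => fun a => `|a|
  | complex_scalars => fun a => Normc.normc a
  end.

Section scalars_theory.
Context (R : realType) (s : scalars).
Local Notation K := (scalar_field R s).
Implicit Types (a b : R) (x y : K).

Lemma normE x : `|x| = of_real s (modulus x).
Proof. by case: s x => x. Qed.

Lemma of_realD a b : of_real s (a + b) = of_real s a + of_real s b.
Proof. by case: s => //=; rewrite rmorphD. Qed.

Lemma of_realM a b : of_real s (a * b) = of_real s a * of_real s b.
Proof. by case: s => //=; rewrite rmorphM. Qed.

Lemma ler_of_real a b : (of_real s a <= of_real s b) = (a <= b).
Proof. by case: s => //=; rewrite lecR. Qed.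

Lemma of_real0 : of_real s (0 : R) = 0.
Proof. by case: s. Qed.

Lemma of_real_inj : injective (@of_real R s).
Proof. by move=> a b /eqP; rewrite eq_le !ler_of_real -eq_le => /eqP. Qed.

Lemma ltr_of_real a b : (of_real s a < of_real s b) = (a < b).
Proof. by rewrite !lt_neqAle ler_of_real (inj_eq of_real_inj). Qed.

Lemma modulus_ge0 x : 0 <= modulus x.
Proof. by rewrite -(ler_of_real 0) of_real0 -normE. Qed.

Lemma modulus0 : modulus (0 : K) = 0.
Proof. by apply: of_real_inj; rewrite -normE of_real0 normr0. Qed.

Lemma modulus_eq0 x : modulus x = 0 -> x = 0.
Proof. by move=> x0; apply/normr0_eq0; rewrite normE x0 of_real0. Qed.

Lemma modulusD x y : modulus (x + y) <= modulus x + modulus y.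
Proof. by rewrite -ler_of_real of_realD -!normE ler_normD. Qed.

Lemma modulusM x y : modulus (x * y) = modulus x * modulus y.
Proof. by apply: of_real_inj; rewrite of_realM -!normE normrM. Qed.

Lemma modulus_of_real a : modulus (of_real s a) = `|a|.
Proof. by case: s => //=; rewrite expr0n/= addr0 sqrtr_sqr. Qed.

End scalars_theory.

Inductive space_kind (R : realType) := c_0 | ell (p : R) of 1 <= p.
Arguments c_0 {R}.

Section space_kind.
Context (R : realType) (s : scalars).
Local Notation K := (scalar_field R s).
Implicit Types (X : space_kind R) (x y : int -> K^o).

Definition in_space X x : Prop :=
  match X with
  | c_0 => (x n%:Z @[n --> \oo] --> (0 : K^o)) /\
           (x (- n%:Z) @[n --> \oo] --> (0 : K^o))
  | ell p _ => (\esum_(n in [set: int]) (modulus (x n) `^ p)%:E < +oo)%E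
  end.

(* [sup] and [fine] take junk values outside the space [X]. *)
Definition space_norm X x : R :=
  match X with
  | c_0 => sup (range (fun n => modulus (x n)))
  | ell p _ => fine (\esum_(n in [set: int]) (modulus (x n) `^ p)%:E) `^ p^-1
  end.

Lemma c_0_bounded x : in_space c_0 x ->
  has_ubound (range (fun n => modulus (x n))).
Proof.
have aux (u : nat -> K^o) : u @ \oo --> (0 : K^o) ->
    exists M : R, forall n, modulus (u n) <= M.
  move=> u0; have e1 : 0 < (1 : K) by [].
  have /cvgrPdist_lt/(_ 1 e1)[N _ uN] := u0.
  exists (1 + \sum_(i < N) modulus (u i)) => n.
  have [Nn|nN] := leqP N n.
    rewrite (@le_trans _ _ 1)//; last first.
      by rewrite lerDl sumr_ge0// => i _; exact: modulus_ge0.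
    have := uN n Nn; rewrite sub0r normrN normE => /ltW.
    have -> : (1 : K) = of_real s 1 by case: (s).
    by rewrite ler_of_real.
  rewrite (bigD1 (Ordinal nN))//= addrCA lerDl addr_ge0//.
  by apply: sumr_ge0 => i _; exact: modulus_ge0.
move=> [/aux[M1 xM1] /aux[M2 xM2]].
exists (Num.max M1 M2) => _ [n _ <-]; rewrite le_max.
case: n => n; first by rewrite xM1.
by rewrite NegzE xM2 orbT.
Qed.

Lemma esumZ (a : R) (f : int -> R) : 0 <= a -> (forall n, 0 <= f n) ->
  (\esum_(n in [set: int]) (a * f n)%:E =
   a%:E * \esum_(n in [set: int]) (f n)%:E)%E.
Proof.
have le (b : R) (g : int -> R) : 0 < b -> (forall n, 0 <= g n) ->
  (\esum_(n in [set: int]) (b * g n)%:E <=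
   b%:E * \esum_(n in [set: int]) (g n)%:E)%E.
  move=> b0 g0; apply: ge_ereal_sup => _ [A [finA _] <-].
  under eq_fsbigr do rewrite EFinM.
  rewrite -ge0_mule_fsumr; last by move=> n; rewrite lee_fin.
  rewrite lee_pmul2l//. by apply: esum_ge; exists A.
rewrite le_eqVlt => /predU1P[<-|a0] f0.
  by rewrite mul0e; apply: esum1 => n _; rewrite mul0r.
apply/eqP; rewrite eq_le le//=.
have := le a^-1 (fun n => a * f n); rewrite invr_gt0 a0 => /(_ isT).
have af0 n : 0 <= a * f n by rewrite mulr_ge0// ltW.
move=> /(_ af0); under eq_esum do rewrite mulKf ?gt_eqF//.
by rewrite -(@lee_pmul2l _ a%:E)// muleA -EFinM divff ?gt_eqF// mul1e.
Qed.

Section ell.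
Variables (p : R) (p1 : 1 <= p).
Local Notation N := (space_norm (ell p1)).
Local Notation S x := (\esum_(n in [set: int]) (modulus (x n) `^ p)%:E)%E.

Let p0 : 0 < p. Proof. exact: lt_le_trans p1. Qed.

Let powRK (a : R) : 0 <= a -> (a `^ p) `^ p^-1 = a.
Proof. by move=> a0; rewrite -powRrM mulfV ?gt_eqF// powRr1. Qed.

Lemma ell_sum_ge0 x : (0 <= S x)%E.
Proof. by apply: esum_ge0 => n _; rewrite lee_fin powR_ge0. Qed.

Lemma ell_norm_ge0 x : 0 <= N x. Proof. exact: powR_ge0. Qed.

Lemma ell_normE x : in_space (ell p1) x -> S x = (N x `^ p)%:E.
Proof.
move=> /= xp; rewrite -powRrM mulVf ?gt_eqF// powRr1 ?fine_ge0 ?ell_sum_ge0//.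
by rewrite fineK// ge0_fin_numE// ell_sum_ge0.
Qed.

Lemma ell_norm_le x (M : R) : 0 <= M -> (S x <= (M `^ p)%:E)%E ->
  in_space (ell p1) x /\ N x <= M.
Proof.
move=> M0 xM; have xp : in_space (ell p1) x by rewrite /= (le_lt_trans xM)// ltry.
split=> //; move: xM; rewrite ell_normE// lee_fin => /(@ge0_ler_powR _ p^-1).
rewrite !nnegrE !powR_ge0 invr_ge0 (ltW p0) => /(_ isT isT isT).
by rewrite !powRK// ell_norm_ge0.
Qed.

Lemma ell_eval x n : in_space (ell p1) x -> modulus (x n) <= N x.
Proof.
move=> xp; have : ((modulus (x n) `^ p)%:E <= S x)%E.
  by apply: esum_ge; exists [set n]; rewrite ?fsbig_set1//; split.
rewrite ell_normE// lee_fin => /(@ge0_ler_powR _ p^-1).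
rewrite !nnegrE !powR_ge0 invr_ge0 (ltW p0) => /(_ isT isT isT).
by rewrite !powRK ?ell_norm_ge0 ?modulus_ge0.
Qed.

Lemma ell_norm_eq0 x : in_space (ell p1) x -> N x = 0 -> x = 0.
Proof.
move=> xp x0; apply/funext => n; apply: modulus_eq0; apply/eqP.
by rewrite eq_le modulus_ge0 andbT -x0 ell_eval.
Qed.

Lemma ellD x y : in_space (ell p1) x -> in_space (ell p1) y ->
  in_space (ell p1) (x + y) /\ N (x + y) <= N x + N y.
Proof.
move=> xp yp; apply: ell_norm_le; first by rewrite addr_ge0 ?ell_norm_ge0.
have [x0|x0] := eqVneq (N x) 0.
  by rewrite (ell_norm_eq0 xp x0) add0r -[X in N X]/(0 : int -> K^o)
     -(ell_norm_eq0 xp x0) x0 add0r ell_normE.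
have [y0|y0] := eqVneq (N y) 0.
  by rewrite (ell_norm_eq0 yp y0) addr0 -(ell_norm_eq0 yp y0) y0 addr0 ell_normE.
have Nx : 0 < N x by rewrite lt_neqAle eq_sym x0 ell_norm_ge0.
have Ny : 0 < N y by rewrite lt_neqAle eq_sym y0 ell_norm_ge0.
move: Nx Ny {x0 y0}; move: {-2}(N x) (erefl (N x)) {-2}(N y) (erefl (N y)) => a Nxa b Nyb Nx Ny.
pose t := a / (a + b).
have ab0 : 0 < a + b by rewrite addr_gt0.
have t01 : 0 <= t <= 1.
  by rewrite /t divr_ge0 ?(ltW Nx) ?(ltW ab0)//= ler_pdivrMr// mul1r lerDl ltW.
have tE : 1 - t = b / (a + b) by rewrite /t; field; rewrite gt_eqF.
pose g (c : R) (z : int -> K^o) n := (c^-1 `^ p) * modulus (z n) `^ p.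
have key n : modulus ((x + y) n) `^ p <=
    (a + b) `^ p * (t * g a x n + (1 - t) * g b y n).
  have h : modulus ((x + y) n) <=
     (a + b) * (t * (modulus (x n) / a) + (1 - t) * (modulus (y n) / b)).
    rewrite tE /t (le_trans (modulusD _ _))// le_eqVlt; apply/orP; left.
    by apply/eqP; field; rewrite !gt_eqF.
  have := @convex_powR R p p1 (@Itv01 _ t (proj1 (andP t01)) (proj2 (andP t01)))
     (modulus (x n) / a) (modulus (y n) / b).
  rewrite !inE/= !in_itv/= !andbT !divr_ge0 ?modulus_ge0 ?(ltW Nx) ?(ltW Ny)//.
  move=> /(_ isT isT); rewrite !convRE/= => cv.
  have le0 : 0 <= t * (modulus (x n) / a) + (1 - t) * (modulus (y n) / b).
    have /andP[t0 t1] := t01.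
    by rewrite addr_ge0// mulr_ge0 ?subr_ge0// divr_ge0 ?modulus_ge0// ltW.
  have := @ge0_ler_powR R p (ltW p0) _ _ _ _ h.
  rewrite !nnegrE modulus_ge0 mulr_ge0// ?(ltW ab0)// => /(_ isT isT) h'.
  rewrite (le_trans h')// powRM ?(ltW ab0)// ler_wpM2l ?powR_ge0//.
  rewrite (le_trans cv)// /g.
  rewrite !powRM ?modulus_ge0 ?invr_ge0 ?(ltW Nx) ?(ltW Ny)//.
  by rewrite [_ `^ p * a^-1 `^ p]mulrC [_ `^ p * b^-1 `^ p]mulrC.
have g0 c z n : 0 <= g c z n by rewrite mulr_ge0 ?powR_ge0.
have Sg c z : 0 < c -> in_space (ell p1) z -> N z = c ->
    (\esum_(n in [set: int]) (g c z n)%:E = 1)%E.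
  move=> c0 zp zc; rewrite esumZ ?powR_ge0//; last by move=> n; exact: powR_ge0.
  rewrite ell_normE// zc -EFinM -powRM ?invr_ge0 ?(ltW c0)//.
  by rewrite mulVf ?gt_eqF// powR1.
have [t0 t1] := andP t01.
have t1' : 0 <= 1 - t by rewrite subr_ge0.
apply: (@le_trans _ _ (\esum_(n in [set: int])
   ((a + b) `^ p * (t * g a x n + (1 - t) * g b y n))%:E)%E).
  by apply: le_esum => n _; rewrite lee_fin.
rewrite esumZ ?powR_ge0//; last by move=> n; rewrite addr_ge0// mulr_ge0.
under eq_esum do rewrite EFinD.
rewrite esumD; [|by move=> n _; rewrite lee_fin mulr_ge0..].
rewrite (esumZ t0)// (esumZ t1')// !Sg// !mule1 -EFinD -EFinM lee_fin.
by rewrite subrKC mulr1.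
Qed.

Lemma ellZ (a : K) x : in_space (ell p1) x ->
  in_space (ell p1) (a *: x) /\ N (a *: x) = modulus a * N x.
Proof.
move=> xp.
have E : S (a *: x) = ((modulus a * N x) `^ p)%:E.
  under eq_esum => n _.
    rewrite /= -[(a *: x) n]/(a * x n) modulusM powRM ?modulus_ge0//.
  over.
  rewrite esumZ ?powR_ge0//; last by move=> n; exact: powR_ge0.
  by rewrite ell_normE// -EFinM powRM ?modulus_ge0 ?ell_norm_ge0.
split; first by rewrite /= E ltry.
by rewrite /= E/= powRK// mulr_ge0 ?modulus_ge0// powR_ge0.
Qed.

End ell.

Section c_0.
Local Notation N := (space_norm c_0).

Lemma c_0_eval x n : in_space c_0 x -> modulus (x n) <= N x.
Proof. by move=> /c_0_bounded xb; apply: ub_le_sup => //; exists n. Qed.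

Lemma c_0_norm_ge0 x : in_space c_0 x -> 0 <= N x.
Proof. by move=> /(c_0_eval 0); apply: le_trans; exact: modulus_ge0. Qed.

Lemma c_0_norm_le x (M : R) : (forall n, modulus (x n) <= M) -> N x <= M.
Proof.
by move=> xM; apply: ge_sup; [exists (modulus (x 0)), 0|move=> _ [n _ <-]].
Qed.

Lemma c_0D x y : in_space c_0 x -> in_space c_0 y ->
  in_space c_0 (x + y) /\ N (x + y) <= N x + N y.
Proof.
move=> xc yc; split.
  by case: xc yc => x1 x2 [y1 y2]; split; rewrite -[0]addr0; apply: cvgD.
apply: c_0_norm_le => n; rewrite (le_trans (modulusD _ _))//.
by rewrite lerD// c_0_eval.
Qed.

Lemma c_0Z (a : K) x : in_space c_0 x ->
  in_space c_0 (a *: x) /\ N (a *: x) = modulus a * N x.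
Proof.
have le (b : K) y : in_space c_0 y -> N (b *: y) <= modulus b * N y.
  move=> yc; apply: c_0_norm_le => n.
  by rewrite -[(b *: y) n]/(b * y n) modulusM ler_wpM2l ?modulus_ge0// c_0_eval.
have cZ (b : K) y : in_space c_0 y -> in_space c_0 (b *: y).
  by move=> [y1 y2]; split; rewrite -[0](scaler0 _ b); apply: cvgZr.
move=> xc; split; first exact: cZ.
apply/eqP; rewrite eq_le le//=.
have [->|a0] := eqVneq a 0.
  by rewrite modulus0 mul0r c_0_norm_ge0//; exact: cZ.
have ma : 0 < modulus a.
  by rewrite lt_neqAle modulus_ge0 andbT eq_sym;
     apply: contra a0 => /eqP/modulus_eq0/eqP.
have := le a^-1 _ (cZ a _ xc); rewrite scalerA mulVf// scale1r.
rewrite -(ler_pM2l ma) mulrA -modulusM divff//.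
suff -> : modulus (1 : K) = 1 by rewrite mul1r.
have -> : (1 : K) = of_real s 1 by case: (s).
by rewrite modulus_of_real normr1.
Qed.

End c_0.

Lemma in_space0 X : in_space X 0.
Proof.
case: X => [|p p1] /=; first by split; exact: cvg_cst.
rewrite esum1 ?ltry// => n _.
by rewrite modulus0 powR0// gt_eqF// (lt_le_trans _ p1).
Qed.

Lemma in_spaceD X x y : in_space X x -> in_space X y -> in_space X (x + y).
Proof.
by case: X => [|p p1] xX yX; [case: (c_0D xX yX)|case: (ellD xX yX)].
Qed.

Lemma in_spaceZ X (a : K) x : in_space X x -> in_space X (a *: x).
Proof. by case: X => [|p p1] xX; [case: (c_0Z a xX)|case: (ellZ a xX)]. Qed.

Lemma space_normD X x y : in_space X x -> in_space X y ->
  space_norm X (x + y) <= space_norm X x + space_norm X y.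
Proof.
by case: X => [|p p1] xX yX; [case: (c_0D xX yX)|case: (ellD xX yX)].
Qed.

Lemma space_normZ X (a : K) x : in_space X x ->
  space_norm X (a *: x) = modulus a * space_norm X x.
Proof. by case: X => [|p p1] xX; [case: (c_0Z a xX)|case: (ellZ a xX)]. Qed.

Lemma space_norm_eval X x n : in_space X x -> modulus (x n) <= space_norm X x.
Proof. by case: X => [|p p1] xX; [exact: c_0_eval|exact: ell_eval]. Qed.

Lemma space_norm_eq0 X x : in_space X x -> space_norm X x = 0 -> x = 0.
Proof.
move=> xX x0; apply/funext => n; apply: modulus_eq0; apply/eqP.
by rewrite eq_le modulus_ge0 andbT -x0 space_norm_eval.
Qed.

Definition space_pred X : {pred int -> K^o} := mem [set x | in_space X x].

Lemma space_predP X x : reflect (in_space X x) (x \in space_pred X).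
Proof. by apply: (iffP idP) => [/set_mem|xX]; [|exact/mem_set]. Qed.

Lemma space_submod X : submod_closed (space_pred X).
Proof.
split; first exact/space_predP/in_space0.
move=> a x y /space_predP xX /space_predP yX; apply/space_predP.
exact/in_spaceD/yX/in_spaceZ.
Qed.

HB.instance Definition _ X :=
  GRing.isSubmodClosed.Build K (int -> K^o) (space_pred X) (space_submod X).

End space_kind.

Record seq_space (R : realType) (s : scalars) (X : space_kind R) := SeqSpace {
  space_val :> int -> (scalar_field R s)^o ;
  space_valP : space_val \in @space_pred R s X }.

Section space_normed.
Context (R : realType) (s : scalars) (X : space_kind R).
Local Notation K := (scalar_field R s).
Local Notation V := (seq_space s X).

HB.instance Definition _ := [isSub for @space_val R s X].
HB.instance Definition _ := [Choice of V by <:].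
HB.instance Definition _ := [SubChoice_isSubLmodule of V by <:].

Lemma spaceP (x : V) : in_space X x.
Proof. exact/space_predP/space_valP. Qed.

Let norm (x : V) : K := of_real s (space_norm X x).

Let normD x y : norm (x + y) <= norm x + norm y.
Proof. by rewrite -of_realD ler_of_real space_normD//; exact: spaceP. Qed.

Let normZ (a : K) x : norm (a *: x) = `|a| * norm x.
Proof. by rewrite normE -of_realM /norm space_normZ//; exact: spaceP. Qed.

Let norm0_eq0 x : norm x = 0 -> x = 0.
Proof.
rewrite -of_real0 => /of_real_inj x0; apply/val_inj => /=.
exact: (space_norm_eq0 (spaceP x) x0).
Qed.

HB.instance Definition _ := Lmodule_isNormed.Build K V normD normZ norm0_eq0.

Lemma space_normrE (x : V) : `|x| = of_real s (space_norm X x).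
Proof. by []. Qed.

End space_normed.

Record weight (R : realType) := Weight {
  weight_val :> int -> R ;
  weight_gt0 : forall n, 0 < weight_val n ;
  weight_bounded : bounded_fun weight_val }.

Section weighted_shift.
Context (R : realType) (s : scalars) (X : space_kind R) (w : weight R).
Local Notation K := (scalar_field R s).
Local Notation V := (seq_space s X).

Definition shift_fun (x : int -> K^o) : int -> K^o :=
  fun n => of_real s (w (n + 1)) * x (n + 1).

Lemma weight_ubound : exists2 M : R, 0 < M & forall n, w n <= M.
Proof.
have [M M0 wM] := ex_strict_bound_gt0 (weight_bounded w).
exists M => // n; rewrite (le_trans (ler_norm _))// ltW//.
exact: wM.
Qed.

Lemma modulus_shift_fun M x n : (forall n, w n <= M) ->
  modulus (shift_fun x n) <= M * modulus (x (n + 1)).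
Proof.
move=> wM; rewrite modulusM modulus_of_real ler_wpM2r ?modulus_ge0//.
by rewrite gtr0_norm ?weight_gt0.
Qed.

Lemma shift_fun_space M (x : int -> K^o) : 0 < M -> (forall n, w n <= M) ->
  in_space X x ->
  in_space X (shift_fun x) /\ space_norm X (shift_fun x) <= M * space_norm X x.
Proof.
move=> M0 wM; case: X => [|p p1] xX.
  split; last first.
    apply: c_0_norm_le => n; rewrite (le_trans (modulus_shift_fun _ _ wM))//.
    by rewrite ler_pM2l// c_0_eval.
  have aux (u v : nat -> K^o) :
      (forall n, modulus (v n) <= M * modulus (u n)) ->
      u @ \oo --> (0 : K^o) -> v @ \oo --> (0 : K^o).
    move=> uv /cvgrPdist_lt u0; apply/cvgrPdist_lt => e e0.
    have Mpos : 0 < of_real s M by rewrite -of_real0 ltr_of_real.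
    have [N _ uN] := u0 (e / of_real s M) (divr_gt0 e0 Mpos).
    exists N => // n Nn; have := uN n Nn; rewrite /= !sub0r !normrN.
    rewrite ltr_pdivlMr//; apply: le_lt_trans.
    by rewrite !normE -of_realM ler_of_real mulrC.
  case: xX => x1 x2; split.
    apply: (aux (fun n => x n.+1%:Z)); last by rewrite (cvg_shiftS (x \o Posz)).
    by move=> n; rewrite (le_trans (modulus_shift_fun _ _ wM))// -PoszD addn1.
  rewrite -cvg_shiftS; apply: (aux (fun n => x (- n%:Z))) => //.
  move=> n; rewrite (le_trans (modulus_shift_fun _ _ wM))//.
  by rewrite -addn1 PoszD opprD subrK.
have p0 : 0 < p := lt_le_trans ltr01 p1.
apply: ell_norm_le; first by rewrite mulr_ge0 ?ell_norm_ge0// ltW.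
apply: (@le_trans _ _ (\esum_(n in [set: int])
    (M `^ p * modulus (x (n + 1)) `^ p)%:E)%E).
  apply: le_esum => n _; rewrite lee_fin -powRM ?modulus_ge0 ?(ltW M0)//.
  have := modulus_shift_fun x n wM; apply: ge0_ler_powR => //; first exact: ltW.
    by rewrite nnegrE modulus_ge0.
  by rewrite nnegrE mulr_ge0 ?modulus_ge0 ?(ltW M0).
rewrite esumZ ?powR_ge0//; last by move=> n; exact: powR_ge0.
rewrite powRM ?ell_norm_ge0 ?(ltW M0)// EFinM -(ell_normE xX).
rewrite lee_wpmul2l ?lee_fin ?powR_ge0//.
rewrite [leRHS](@reindex_esum _ _ _ [set: int] _ (fun n => n + 1))//; split=> //.
  by move=> m n _ _ /addIr.
by move=> n _; exists (n - 1) => //; rewrite subrK.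
Qed.

Lemma shift_fun_in (x : V) : shift_fun x \in @space_pred R s X.
Proof.
have [M M0 wM] := weight_ubound; apply/space_predP.
by case: (shift_fun_space M0 wM (spaceP x)).
Qed.

Definition weighted_shift (x : V) : V := SeqSpace (shift_fun_in x).

Lemma weighted_shift_linear : linear weighted_shift.
Proof.
move=> a x y; apply/val_inj/funext => n.
rewrite /= /shift_fun -![RHS]/(a * _ + _).
by rewrite -![LHS]/(_ * (a * _ + _)) mulrDr mulrCA.
Qed.

HB.instance Definition _ :=
  GRing.isLinear.Build K V V _ weighted_shift weighted_shift_linear.

Lemma weighted_shift_continuous : continuous weighted_shift.
Proof.
have [M M0 wM] := weight_ubound.
apply/bounded_linear_continuous/linear_boundedP.
exists (of_real s M); split.
  by rewrite realE -of_real0 ler_of_real (ltW M0).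
move=> r Mr x; rewrite (@le_trans _ _ (of_real s M * `|x|))//; last first.
  by rewrite ler_wpM2r// ltW.
rewrite !space_normrE -of_realM ler_of_real.
by case: (shift_fun_space M0 wM (spaceP x)).
Qed.

End weighted_shift.
Arguments weighted_shift {R} s X w _.

(* Main.v *)
(* Suppose the shift [T] is F-mixing and [N(W,W) = A] up to [0].  Return sets of
   a mixing operator form a filter base, and [n - i] (resp. [n + i]) lies in
   [N(W,W)] as soon as [n] lies in [N(T^-i W, W)] (resp. [N(W, T^-i W)]); so the
   intersection of finitely many translates of [A] is in the family, up to a
   finite set, which fullness allows us to ignore.

   Conversely let [h n] be the distance from [|n|] to the complement of
   [A \ {0}], and let [w_n = 4 ^ (h n - h (n - 1))].  As [h] is 1-Lipschitz, [w]
   takes values in [[1/4, 4]].  One has [T^n e_j = 4 ^ (h j - h (j - n)) e_(j-n)],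
   and, [h] being even, [T^-1] is conjugate to [T] by the reflection of the
   indices.  Hence [T^n] and [T^-n] tend to [0] on finite sequences as
   [h n] tends to infinity, and [h n > k] on a set of the family when [A] is in
   the tilde family: [T] is mixing.  For the ball [W] of radius [1/2] about
   [e_0]: if [h n > 0] then [e_0 + 4 ^ (- h n) e_n] is in [W] and is sent
   into [W]; if [h n = 0 < n] then [(T^n x)_0] has modulus at most [|x_n|], and
   [|x_n| < 1/2] for [x] in [W]. *)
Require Import Defs.
From mathcomp Require Import all_boot all_order all_algebra.
From mathcomp Require Import all_classical all_reals all_analysis.
From mathcomp Require Import zify lra.
Set Implicit Arguments.
Unset Strict Implicit.
Unset Printing Implicit Defensive.
Import Order.TTheory GRing.Theory Num.Theory.
Import numFieldNormedType.Exports.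
Local Open Scope classical_set_scope.
Local Open Scope ring_scope.

(** * Full families and the tilde family *)

(** If [B \ D] were not in [F], it would contain no member of [F], so its complement would be in the
    dual. Fullness would then make the part of [B] in that complement infinite, but this part lies
    in [D]. *)
Lemma full_family_setD (F : set (set nat)) (B D : set nat) :
  furstenberg_family F -> full_family F -> F B -> finite_set D ->
  F (B `\` D).
Proof.
move=> [_ _ Fup] Ffull FB finD; apply: contrapT => nF.
have dual : dual_family F (~` (B `\` D)).
  move=> C FC; apply: contrapT => /nonemptyPn CD; apply: nF.
  by apply: (Fup _ _ FC); rewrite -[X in _ `<=` X]setCK -disjoints_subset setIC.
apply: (Ffull _ _ FB dual); apply: sub_finite_set finD => n [Bn nBD].
by apply: contrapT => nD; apply: nBD.
Qed.

(** Turns the intersection of integer translates into equations suited to [lia]. *)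
Lemma tilde_familyP (F : set (set nat)) (A : set nat) :
  tilde_family F A <->
  F A /\ forall k, F [set n | forall i : int, - k%:Z <= i <= k%:Z ->
    exists2 m, A m & n = m%:Z + i :> int].
Proof.
suff E k : Posz @^-1` (\bigcap_(i in [set i : int | - k%:Z <= i <= k%:Z])
      translate A i) =
    [set n | forall i : int, - k%:Z <= i <= k%:Z ->
      exists2 m, A m & n = m%:Z + i :> int].
  by split=> -[FA FAk]; split=> // k; have := FAk k; rewrite E.
apply/seteqP; split=> n /= An i ik.
  by have [m Am mn] := An i ik; exists m.
by have [m Am mn] := An i ik; exists m.
Qed.

(** * Return sets of a mixing operator *)

Section transitivity.
Context (V : topologicalType) (F : set (set nat)) (T : V -> V).
Hypotheses (F_family : furstenberg_family F) (T_cont : continuous T).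

Lemma iter_continuous n : continuous (iter n T).
Proof.
elim: n => [|n IH] x; first exact: cvg_id.
exact: (@continuous_comp _ _ _ (iter n T) T x (IH x) (@T_cont _)).
Qed.

Lemma open_iter_preimage n (U : set V) : open U -> open (iter n T @^-1` U).
Proof. by have /continuousP := @iter_continuous n; exact. Qed.

Lemma return_setP (U W : set V) n :
  return_set T U W n <-> exists2 x, U x & W (iter n T x).
Proof.
split=> [[_ [[x Ux <-] Wx]]|[x Ux Wx]]; first by exists x.
by exists (iter n T x); split=> //; exists x.
Qed.

Hypothesis T_mixing : family_mixing F T.

(** The return set of the direct sum from the product of [U] and [U'] to that of [W] and [W'] lies
    in this intersection. *)
Lemma mixing_return_setI (U W U' W' : set V) :
  open U -> U !=set0 -> open W -> W !=set0 ->
  open U' -> U' !=set0 -> open W' -> W' !=set0 ->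
  F (return_set T U W `&` return_set T U' W').
Proof.
have openX (A B : set V) : open A -> open B -> open (A `*` B).
  rewrite !openE => oA oB [a b] [/= Aa Bb]; exists (A, B) => //=; split.
    exact: oA.
  exact: oB.
move=> oU [x Ux] oW [y Wy] oU' [x' Ux'] oW' [y' Wy'].
have [_ _ Fup] := F_family.
apply: (Fup _ _ (T_mixing (openX _ _ oU oU') _ (openX _ _ oW oW') _)).
- by exists (x, x').
- by exists (y, y').
have iterE n z : iter n (direct_sum T) z = (iter n T z.1, iter n T z.2).
  by elim: n => [|n IH]; [case: z|rewrite !iterS IH].
move=> n [_ [[[z z'] [/= Uz Uz'] <-]]]; rewrite iterE /= => -[/= Wz Wz'].
by split; apply/return_setP; [exists z|exists z'].
Qed.

(* If [T^m] sends points of [U] into [U'] and points of [W] into [W'], then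
   restricting to [U `&` T^-m U'] and [W `&` T^-m W'] works, because [T^m]
   commutes with [T^n]. *)
Lemma mixing_return_set_filter (U W U' W' : set V) :
  open U -> U !=set0 -> open W -> W !=set0 ->
  open U' -> U' !=set0 -> open W' -> W' !=set0 ->
  exists U'' W'', [/\ open U'', U'' !=set0, open W'', W'' !=set0 &
    return_set T U'' W'' `<=` return_set T U W `&` return_set T U' W'].
Proof.
move=> oU U0 oW W0 oU' U'0 oW' W'0; have [_ F0 _] := F_family.
have : return_set T U U' `&` return_set T W W' !=set0.
  apply: contrapT => /nonemptyPn E; apply: F0; rewrite -E.
  exact: mixing_return_setI.
move=> [m [/return_setP[x Ux Ux'] /return_setP[y Wy Wy']]].
exists (U `&` iter m T @^-1` U'), (W `&` iter m T @^-1` W'); split.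
- exact/openI/open_iter_preimage.
- by exists x.
- exact/openI/open_iter_preimage.
- by exists y.
move=> n /return_setP[z [Uz Uz'] [Wz Wz']].
split; apply/return_setP; first by exists z.
exists (iter m T z) => //; move: Wz'.
by rewrite /preimage /= -!iterD addnC.
Qed.

Lemma mixing_return_set_bigcap (U W : nat -> set V) k :
  (forall i, [/\ open (U i), U i !=set0, open (W i) & W i !=set0]) ->
  exists U' W', [/\ open U', U' !=set0, open W', W' !=set0 &
    forall n, return_set T U' W' n ->
      forall i, (i <= k)%N -> return_set T (U i) (W i) n].
Proof.
move=> UW; elim: k => [|k [U' [W' [oU' U'0 oW' W'0 sub]]]].
  have [oU U0 oW W0] := UW 0%N; exists (U 0%N), (W 0%N); split=> // n Nn i.
  by rewrite leqn0 => /eqP ->.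
have [oU U0 oW W0] := UW k.+1.
have [U2 [W2 [oU2 U20 oW2 W20 sub2]]] :=
  mixing_return_set_filter oU' U'0 oW' W'0 oU U0 oW W0.
exists U2, W2; split=> // n /sub2[Nn Nn'] i.
by rewrite leq_eqVlt ltnS => /predU1P[->//|]; exact: sub.
Qed.

Hypotheses (F_full : full_family F) (T_surj : forall y, exists x, T x = y).

Lemma mixing_return_set_tilde (W : set V) (A : set nat) :
  open W -> W !=set0 -> return_set T W W = A `|` [set 0%N] ->
  tilde_family F A.
Proof.
move=> oW W0 WA; have [_ _ Fup] := F_family.
have Tn_surj n y : exists x, iter n T x = y.
  elim: n y => [|n IH] y; first by exists y.
  by have [z <-] := T_surj y; have [x <-] := IH z; exists x.
pose P i := iter i T @^-1` W.
have oP i : open (P i) by exact: open_iter_preimage.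
have P0 i : P i !=set0.
  by have [y Wy] := W0; have [x xy] := Tn_surj i y; exists x; rewrite /P /= xy.
have posA n : (0 < n)%N -> return_set T W W n -> A n.
  by rewrite WA => n0 [//|/= n0']; rewrite n0' in n0.
apply/tilde_familyP; split.
  have := mixing_return_setI oW W0 oW W0 oW W0 oW W0; rewrite setIid => FW.
  have := full_family_setD F_family F_full FW (finite_set1 0%N).
  by move=> /Fup; apply=> n [Wn /= n0]; apply: posA => //; rewrite lt0n; apply/eqP.
move=> k.
(* Return times from [U1] to [W1] serve the [n - i], those from [U2] to [W2] the [n + i], for all
   [i <= k] at once. *)
have [U1 [W1 [oU1 U10 oW1 W10 sub1]]] := @mixing_return_set_bigcap P (fun=> W) k
  (fun i => And4 (oP i) (P0 i) oW W0).
have [U2 [W2 [oU2 U20 oW2 W20 sub2]]] := @mixing_return_set_bigcap (fun=> W) P k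
  (fun i => And4 oW W0 (oP i) (P0 i)).
have := mixing_return_setI oU1 U10 oW1 W10 oU2 U20 oW2 W20.
(* Keeping only [n > k] makes each [n - i] positive; a return at time 0 says nothing about [A]. *)
move=> /(full_family_setD F_family F_full)/(_ (finite_II k.+1)).
move=> /Fup; apply=> n [[/sub1 N1 /sub2 N2] /= kn] i ik.
have {}kn : (k < n)%N by rewrite ltnNge; apply/negP => nk; apply: kn; rewrite ltnS.
have [i0|i0] := leP 0 i.
  have E : n = (n - `|i| + `|i|)%N by lia.
  exists (n - `|i|)%N; last by lia.
  apply: posA; first by lia.
  have /return_setP[x Px Wx] := N1 `|i|%N ltac:(lia).
  by apply/return_setP; exists (iter `|i| T x) => //; rewrite -iterD -E.
exists (n + `|i|)%N; last by lia.
apply: posA; first by lia.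
have /return_setP[x Wx Px] := N2 `|i|%N ltac:(lia).
by apply/return_setP; exists x => //; rewrite addnC iterD.
Qed.

End transitivity.

(** * Distance to the complement of [A] without 0 *)

Section depth.
Variable A : set nat.

(** Boolean, so that [ex_minn] gives the least [m]; the two inequalities express [|n - a| <= m]
    without truncated subtraction. *)
Definition near_complement n m : bool :=
  `[< exists a, [/\ ~ (A `\ 0%N) a, (n <= a + m)%N & (a <= n + m)%N] >].

Lemma near_complement_ex n : exists m, near_complement n m.
Proof. by exists n; apply/asboolP; exists 0%N; split=> //; case=> _; exact. Qed.

(* The distance from [n] to the complement of [A `\ 0]; removing [0] makes it
   vanish at [0]. *)
Definition depth n := ex_minn (near_complement_ex n).

(** Triangle inequality: a point of the complement within [q] of [n] is within [q + d] of [m]. *)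
Lemma depth_lip m n d : (m <= n + d)%N -> (n <= m + d)%N ->
  (depth m <= depth n + d)%N.
Proof.
move=> mn nm; rewrite /depth; case: ex_minnP => p _ minp.
case: ex_minnP => q /asboolP[a [Aa na an]] _; apply: minp.
by apply/asboolP; exists a; split=> //; lia.
Qed.

Lemma depth_eq0 n : ~ (A `\ 0%N) n -> depth n = 0%N.
Proof.
move=> An; rewrite /depth; case: ex_minnP => m _ /(_ 0%N) min0.
by apply/eqP; rewrite -leqn0; apply: min0; apply/asboolP; exists n; split=> //; lia.
Qed.

Lemma ltn_depth k n :
  (forall a, (n <= a + k)%N -> (a <= n + k)%N -> (A `\ 0%N) a) ->
  (k < depth n)%N.
Proof.
move=> An; rewrite /depth; case: ex_minnP => m /asboolP[a [Aa na an]] _.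
by rewrite ltnNge; apply/negP => mk; apply: Aa; apply: An; lia.
Qed.

(** For [n] in the [k]-th intersection and [a] within [k] of [n], the translate by [n - a] shows
    that [a] is in [A]; discarding the [n <= k] ensures that [a] is not 0. *)
Lemma tilde_family_depth (F : set (set nat)) k :
  furstenberg_family F -> full_family F -> tilde_family F A ->
  F [set n | (k < depth n)%N].
Proof.
move=> F_family F_full /tilde_familyP[_ /(_ k) FAk].
have [_ _ Fup] := F_family.
have := full_family_setD F_family F_full FAk (finite_II k.+1).
move=> /Fup; apply=> n [An /= kn]; apply: ltn_depth => a na an.
have {}kn : (k < n)%N by rewrite ltnNge; apply/negP => nk; apply: kn; rewrite ltnS.
split; last by move=> /= a0; lia.
have [|m Am E] := An (n%:Z - a%:Z); first lia.
by have -> : a = m by lia.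
Qed.

(** The even extension, so that the shift and its inverse are mirror images. *)
Definition height (j : int) : int := (depth `|j|%N)%:Z.

Lemma heightN j : height (- j) = height j.
Proof. by rewrite /height abszN. Qed.

Lemma height0 : height 0 = 0.
Proof. by rewrite /height depth_eq0// => -[_]; exact. Qed.

Lemma height_lip i j : height i <= height j + `|i - j|.
Proof.
rewrite /height; have := @depth_lip `|i|%N `|j|%N `|i - j|%N.
lia.
Qed.

End depth.

(** * Real-valued norm, reflection and density of finite sequences *)

Section sequence_space.
Context (R : realType) (s : scalars) (X : space_kind R).
Local Notation K := (scalar_field R s).
Local Notation V := (seq_space s X).
Local Notation nnorm := (fun x : V => space_norm X x).

Lemma nnormD (x y : V) : nnorm (x + y) <= nnorm x + nnorm y.
Proof. by have := ler_normD x y; rewrite !space_normrE -of_realD ler_of_real. Qed.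

Lemma nnormN (x : V) : nnorm (- x) = nnorm x.
Proof. by have := normrN x; rewrite !space_normrE => /of_real_inj. Qed.

Lemma nnormB_ltD (x y z : V) (a b : R) :
  nnorm (x - y) < a -> nnorm z < b -> nnorm (x - (y + z)) < a + b.
Proof.
move=> xy z0; rewrite opprD addrA; apply: le_lt_trans (nnormD _ _) _.
by rewrite nnormN ltrD.
Qed.

Lemma open_nnormP (W : set V) :
  open W <-> forall x, W x ->
    exists2 e : R, 0 < e & forall y, nnorm (x - y) < e -> W y.
Proof.
have nbhsE (x : V) : nbhs x W <->
    exists2 e : R, 0 < e & forall y, nnorm (x - y) < e -> W y.
  split=> [/nbhs_normP[/= e e0 eW]|[e e0 eW]].
    (* A positive element of [K] is real, so it equals its modulus. *)
    have E : of_real s (modulus e) = e by rewrite -normE gtr0_norm.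
    exists (modulus e); first by rewrite -(ltr_of_real s) of_real0 E.
    by move=> y; rewrite -(ltr_of_real s) E => xy; apply: eW; rewrite /= space_normrE.
  apply/nbhs_normP; exists (of_real s e) => /=.
    by rewrite -(of_real0 R s) ltr_of_real.
  by move=> y /=; rewrite space_normrE ltr_of_real; exact: eW.
by rewrite openE; split=> oW x /oW /nbhsE.
Qed.

Lemma open_nnorm_ball (x : V) (e : R) : open [set y : V | nnorm (x - y) < e].
Proof.
apply/open_nnormP => y /= xy; exists (e - nnorm (x - y)); first by rewrite subr_gt0.
move=> z yz; have := nnormD (x - y) (y - z); rewrite subrKA => xz.
by apply: le_lt_trans xz _; rewrite addrC -ltrBrDr.
Qed.

(** For [c_0] the two limits are exchanged; for [ell] the sum is reindexed. *)
Lemma in_space_reflect (x : int -> K^o) : in_space X x ->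
  in_space X (x \o -%R) /\ space_norm X (x \o -%R) = space_norm X x.
Proof.
case: X => [|p p1] xX.
  split.
    case: xX => x1 x2; split; first exact: x2.
    suff -> : (fun n : nat => (x \o -%R) (- n%:Z)) = (fun n : nat => x n%:Z) by [].
    by apply/funext => n; rewrite [LHS]/= opprK.
  congr sup; apply/seteqP; split=> _ [n _ <-]; exists (- n) => //=.
  by rewrite opprK.
have E : (\esum_(n in [set: int]) (modulus (x (- n)) `^ p)%:E =
          \esum_(n in [set: int]) (modulus (x n) `^ p)%:E)%E.
  apply/esym/(@reindex_esum _ _ _ [set: int] [set: int] -%R
    (fun n => (modulus (x n) `^ p)%:E)).
  by split=> // [m n _ _ /oppr_inj//|n _]; exists (- n); rewrite ?opprK.
split; first exact: (eq_ind_r (fun z => (z < +oo)%E) xX E).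
exact: (congr1 (fun z => fine z `^ p^-1) E).
Qed.

Lemma reflect_subproof (x : V) : (x \o -%R : int -> K^o) \in @space_pred R s X.
Proof. exact/space_predP/(in_space_reflect (spaceP x)).1. Qed.

Definition reflection (x : V) : V := SeqSpace (reflect_subproof x).

Lemma nnorm_reflection (x : V) : nnorm (reflection x) = nnorm x.
Proof. exact: (in_space_reflect (spaceP x)).2. Qed.

Lemma reflectionB (x y : V) : reflection (x - y) = reflection x - reflection y.
Proof. exact/val_inj/funext. Qed.

Lemma reflection_continuous : continuous reflection.
Proof.
apply/continuousP => W /open_nnormP oW; apply/open_nnormP => x /= /oW[e e0 eW].
exists e; first exact: e0.
move=> y xy; apply: eW.
have E : nnorm (reflection x - reflection y) = nnorm (x - y).
  by rewrite -reflectionB; exact: nnorm_reflection.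
exact: (eq_ind_r (fun r => r < e) xy E).
Qed.

Definition delta_fun (j : int) : int -> K^o := fun n => (n == j)%:R.

Lemma modulus1 : modulus (1 : K) = 1.
Proof.
have -> : (1 : K) = of_real s 1 by case: (s).
by rewrite modulus_of_real normr1.
Qed.

Lemma modulusN (a : K) : modulus (- a) = modulus a.
Proof. by apply: (@of_real_inj R s); rewrite -!normE normrN. Qed.

Lemma modulus_delta_fun j n : modulus (delta_fun j n : K) = (n == j)%:R.
Proof. by rewrite /delta_fun; case: eqP => _; rewrite ?modulus1 ?modulus0. Qed.

Lemma delta_fun_space j :
  in_space X (delta_fun j) /\ space_norm X (delta_fun j) = 1.
Proof.
have le1 : in_space X (delta_fun j) /\ space_norm X (delta_fun j) <= 1.
  case: X => [|p p1].
    split; last by apply: c_0_norm_le => n; rewrite modulus_delta_fun lern1 leq_b1.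
    split; apply: cvg_near_cst; exists `|j|.+1%N => // n /= jn.
      by rewrite /delta_fun; case: eqP => // nj; lia.
    by rewrite /delta_fun; case: eqP => // nj; lia.
  apply: ell_norm_le => //; rewrite powR1.
  rewrite (@esumID _ _ [set j])//; last by move=> n _; rewrite lee_fin powR_ge0.
  rewrite [X in (_ + X)%E]esum1 ?adde0.
    by rewrite setTI esum_set1 ?lee_fin ?powR_ge0// modulus_delta_fun eqxx powR1.
  move=> n [_ /= nj]; rewrite modulus_delta_fun; case: eqP => // _.
  by rewrite powR0// gt_eqF// (lt_le_trans ltr01).
split; first exact: le1.1.
(* The lower bound comes from coordinate [j]. *)
apply: le_anti; rewrite le1.2/=.
by have := space_norm_eval j le1.1; rewrite modulus_delta_fun eqxx.
Qed.

Lemma delta_subproof j : delta_fun j \in @space_pred R s X.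
Proof. exact/space_predP/(delta_fun_space j).1. Qed.

Definition delta (j : int) : V := SeqSpace (delta_subproof j).

Lemma nnorm_delta (a : K) j : nnorm (a *: delta j) = modulus a.
Proof.
have := congr1 (fun r => modulus a * r) (delta_fun_space j).2.
by rewrite mulr1; apply: etrans; exact: (space_normZ a (spaceP (delta j))).
Qed.

Lemma reflection_delta a j : reflection (a *: delta j) = a *: delta (- j).
Proof.
apply/val_inj/funext => n.
exact: (congr1 (fun b : bool => a * b%:R) (eqr_oppLR n j)).
Qed.

(** In [c_0] all but finitely many coordinates have modulus below [e]; in [ell] some finite subsum
    comes within [e ^ p] of the total. *)
Lemma in_space_tail (x : int -> K^o) (e : R) : in_space X x -> 0 < e ->
  exists D : seq int,
    space_norm X (fun n => if n \in D then 0 else x n : K^o) <= e.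
Proof.
case: X => [|p p1] xX e0.
  have eK : (0 : K) < of_real s e by rewrite -(of_real0 R s) ltr_of_real.
  case: xX => /cvgrPdist_lt/(_ _ eK)[N1 _ xN1] /cvgrPdist_lt/(_ _ eK)[N2 _ xN2].
  exists (map Posz (iota 0 N1) ++ map (fun n : nat => - n%:Z) (iota 0 N2)).
  apply: c_0_norm_le => n; case: ifPn => [_|]; first by rewrite modulus0 ltW.
  rewrite mem_cat negb_or => /andP[n1 n2].
  rewrite -(ler_of_real s) -normE -[leLHS]normrN -sub0r ltW//.
  have [n0|n0] := leP 0 n.
    have E : n = `|n|%N by lia.
    rewrite E; apply: xN1; rewrite /= leqNgt; apply: contra n1 => nN.
    by rewrite E map_f// mem_iota.
  have E : n = - (`|n|%N)%:Z by lia.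
  rewrite E; apply: xN2; rewrite /= leqNgt; apply: contra n2 => nN.
  by rewrite E (map_f (fun n : nat => - n%:Z))// mem_iota.
have p0 : 0 < p := lt_le_trans ltr01 p1.
pose a n := (modulus (x n) `^ p)%:E.
have a0 n : (0 <= a n)%E by rewrite lee_fin powR_ge0.
have Sfin : (\esum_(n in [set: int]) a n)%E \is a fin_num.
  by rewrite ge0_fin_numE// esum_ge0.
have [_ [D [finD _] <-]] := ub_ereal_sup_adherent (powR_gt0 p e0) Sfin.
rewrite -/(esum _ _) => SD; have [r rE] := (finite_seqP D).1 finD.
exists r; apply: (@ell_norm_le R s p p1 _ e (ltW e0) _).2.
move: SD; rewrite (@esumID _ _ D); last by move=> i _; exact: a0.
rewrite !setTI esum_fset//; last by move=> i _; exact: a0.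
have Dfin : (\sum_(i \in D) a i)%E \is a fin_num by rewrite fsumEFin.
rewrite lteBlDr// lteD2lE// => /ltW; apply: le_trans.
rewrite [leRHS]esum_mkcond; apply: le_esum => n _.
have -> : (n \in ~` D) = (n \notin r).
  by rewrite in_setC rE; congr (~~ _); apply/idP/idP => [/set_mem|/mem_set].
by case: (n \in r); rewrite //= modulus0 powR0// gt_eqF.
Qed.

(** Such a [P] holds for all finite sequences, in particular for truncations of [x]. It is meant for
    decay of orbits under the shift or its inverse. *)
Lemma delta_span_dense (P : V -> Prop) (x : V) (e : R) : 0 < e ->
  P 0 -> (forall y z, P y -> P z -> P (y + z)) ->
  (forall a j, P (a *: delta j)) ->
  exists2 y, P y & nnorm (x - y) < e.
Proof.
move=> e0 P0 PD Pdelta.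
have e2 : 0 < e / 2 by rewrite divr_gt0.
have [D De] := in_space_tail (spaceP x) e2.
(* [undup], since a repeated index would contribute its term twice. *)
exists (\sum_(j <- undup D) x j *: delta j).
  by apply: big_ind => // j _.
apply: (@le_lt_trans _ _ (e / 2)); last by rewrite ltr_pdivrMr// ltr_pMr// ltr1n.
suff -> : space_val (x - \sum_(j <- undup D) x j *: delta j) =
  (fun n => if n \in D then 0 else x n) by [].
apply/funext => n.
have E (r : seq int) : uniq r ->
    (\sum_(j <- r) x j *: delta j : V) n = if n \in r then x n else 0.
  elim: r => [_|j r IH /= /andP[jr ur]]; first by rewrite big_nil.
  rewrite big_cons -[LHS]/(x j * delta_fun j n + (\sum_(j <- r) x j *: delta j : V) n).
  rewrite IH// in_cons /delta_fun; case: eqP => [->|_] /=.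
    by rewrite (negPf jr) addr0 mulr1.
  by rewrite mulr0 add0r.
rewrite -[LHS]/(x n - (\sum_(j <- undup D) x j *: delta j : V) n).
by rewrite E ?undup_uniq// mem_undup; case: ifP; rewrite ?subrr ?subr0.
Qed.

End sequence_space.

(** * The shift with weights [4 ^ (h n - h (n - 1))] *)

Section height_shift.
Context (R : realType) (s : scalars) (X : space_kind R) (h : int -> int).
Hypothesis h_lip : forall i j, h i <= h j + `|i - j|.
Local Notation K := (scalar_field R s).
Local Notation V := (seq_space s X).
Local Notation nnorm := (fun x : V => space_norm X x).

Definition step (n : int) : R := 4 ^ (h n - h (n - 1)).

Lemma step_gt0 n : 0 < step n.
Proof. by rewrite exprz_gt0. Qed.

Lemma step_bounded : bounded_fun step.
Proof.
exists 4; split => // M M4 n _; rewrite /= gtr0_norm ?step_gt0// (le_trans _ (ltW M4))//.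
rewrite -[leRHS]expr1z ler_eXz2l ?ltr1n//.
by have := h_lip n (n - 1); lia.
Qed.

Definition height_weight : weight R := Weight step_gt0 step_bounded.

Local Notation T := (weighted_shift s X height_weight).
Local Notation ratio i j := (of_real s (4 ^ (h i - h j)) : K).

Lemma ratioM i j k l : h i - h j + (h k - h l) = 0 ->
  ratio i j * ratio k l = 1.
Proof.
move=> E; rewrite -of_realM -expfzDr ?pnatr_eq0// E expr0z.
by case: (s).
Qed.

(** The product of the weights at [m + 1], ..., [m + n] telescopes. *)
Lemma iter_height_shift n (x : V) m :
  iter n T x m = ratio (m + n%:Z) m * x (m + n%:Z).
Proof.
elim: n m => [|n IH] m.
  by rewrite addr0 subrr expr0z; case: (s) x => x; rewrite /= ?rmorph1 mul1r.
rewrite iterS -[LHS]/(of_real s (4 ^ (h (m + 1) - h (m + 1 - 1))) * iter n T x (m + 1)).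
have E : m + 1 + n%:Z = m + n.+1%:Z by lia.
rewrite IH E addrK mulrA -of_realM -expfzDr ?pnatr_eq0//.
by congr (of_real _ (_ ^ _) * _); lia.
Qed.

Lemma iter_height_shift_delta n a j :
  iter n T (a *: delta s X j) = (a * ratio j (j - n%:Z)) *: delta s X (j - n%:Z).
Proof.
apply/val_inj/funext => m; apply: etrans (iter_height_shift n _ m) _.
rewrite -[LHS]/(_ * (a * (m + n%:Z == j)%:R)) -[RHS]/(_ * (m == j - n%:Z)%:R).
rewrite -subr_eq opprK eq_sym.
by case: eqP => [->|_]; rewrite ?mulr0// !mulr1 addrK mulrC.
Qed.

Lemma iter_height_shiftD n x y : iter n T (x + y) = iter n T x + iter n T y.
Proof. by elim: n => //= n ->; exact: linearD. Qed.

Hypothesis hN : forall j : int, h (- j) = h j.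

(** This is the inverse of [T^n] because [h] is even; as the reflection is an isometry, continuity
    and norm estimates carry over from [T]. *)
Definition backward n (x : V) : V := reflection (iter n T (reflection x)).

Lemma backwardE n (x : V) m : backward n x m = ratio (m - n%:Z) m * x (m - n%:Z).
Proof.
apply: etrans (iter_height_shift n _ (- m)) _.
have E : - (m - n%:Z) = - m + n%:Z by rewrite opprB addrC.
by rewrite /= -E opprK !hN.
Qed.

Lemma backwardK n : cancel (backward n) (iter n T).
Proof.
move=> x; apply/val_inj/funext => m; apply: etrans (iter_height_shift n _ m) _.
rewrite backwardE addrK mulrA ratioM ?mul1r//.
by rewrite subrKA subrr.
Qed.

Lemma iter_height_shiftK n : cancel (iter n T) (backward n).
Proof.
move=> x; apply/val_inj/funext => m; apply: etrans (backwardE n _ m) _.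
rewrite iter_height_shift subrK mulrA ratioM ?mul1r//.
by rewrite subrKA subrr.
Qed.

Lemma height_shift_invertible : invertible T.
Proof.
exists (backward 1); split.
- exact: (iter_height_shiftK 1).
- exact: (backwardK 1).
- move=> x; apply: (@continuous_comp _ _ _ (iter 1 T \o @reflection R s X)).
    apply: (@continuous_comp _ _ _ (@reflection R s X)).
      exact: reflection_continuous.
    exact: weighted_shift_continuous.
  exact: reflection_continuous.
Qed.

(** * Mixing, by a criterion of Kitai type *)

Definition vanishing (x : V) : Prop := forall e : R, 0 < e ->
  exists k : nat, forall n : nat, k%:Z < h n%:Z -> nnorm (iter n T x) < e.

Lemma vanishingD x y : vanishing x -> vanishing y -> vanishing (x + y).
Proof.
move=> vx vy e e0; have e2 : 0 < e / 2 by rewrite divr_gt0.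
have [k xk] := vx _ e2; have [l yl] := vy _ e2.
exists (maxn k l) => n kn; rewrite iter_height_shiftD (splitr e).
apply: le_lt_trans (nnormD _ _) _; apply: ltrD.
  by apply: xk; lia.
by apply: yl; lia.
Qed.

(* [T^n e_j] has norm [4 ^ (h j - h (j - n))], and [h (j - n)] differs from
   [h n] by at most [|j|]. *)
Lemma vanishing_delta a j : vanishing (a *: delta s X j).
Proof.
move=> e e0; pose C := modulus a * 4 ^ (h j + `|j|).
have C0 : 0 <= C by rewrite mulr_ge0 ?modulus_ge0// exprz_ge0.
(* Since [C / e < k < 4 ^ k], the bound [C * 4 ^ (- k)] is below [e]. *)
pose k := Num.bound (C / e); exists k => n kn.
rewrite iter_height_shift_delta.
apply: le_lt_trans (_ : C * 4 ^ (- k%:Z) < e).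
  have E : space_norm X ((a * ratio j (j - n%:Z)) *: delta s X (j - n%:Z)) =
      modulus a * 4 ^ (h j - h (j - n%:Z)).
    apply: etrans (nnorm_delta _ _ _) _.
    by rewrite modulusM modulus_of_real ger0_norm// exprz_ge0.
  apply: (eq_ind_r (fun r => r <= _) _ E).
  rewrite /C -mulrA ler_wpM2l ?modulus_ge0// -expfzDr ?pnatr_eq0//.
  rewrite ler_eXz2l ?ltr1n//.
  have hnj : h (n%:Z - j) = h (j - n%:Z) by rewrite -hN opprB.
  have := h_lip n%:Z (n%:Z - j); rewrite hnj.
  by lia.
rewrite -exprnN ltr_pdivrMr ?exprn_gt0// mulrC -ltr_pdivrMr//.
apply: lt_trans (archi_boundP _) _; first by rewrite divr_ge0// ltW.
by rewrite -natrX ltr_nat ltn_expl.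
Qed.

Lemma vanishing0 : vanishing 0.
Proof. by have := vanishing_delta 0 0; rewrite scale0r. Qed.

(** Approximate [x] by [x'] with [T^n x'] small and [y] by [y'] with [T^-n y'] small; then
    [x' + T^-n y'] is close to [x] and its image [T^n x' + y'] is close to [y]. *)
Lemma height_shift_return (U W : set V) :
  open U -> U !=set0 -> open W -> W !=set0 ->
  exists k : nat, forall n : nat, k%:Z < h n%:Z -> return_set T U W n.
Proof.
move=> /open_nnormP oU [x /oU[e e0 eU]] /open_nnormP oW [y /oW[d d0 dW]].
have e2 : 0 < e / 2 by rewrite divr_gt0.
have d2 : 0 < d / 2 by rewrite divr_gt0.
have [x' vx xx'] := delta_span_dense x e2 vanishing0 vanishingD vanishing_delta.
have refl0 : reflection (0 : V) = 0 by exact/val_inj/funext.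
have reflD (u v : V) : reflection (u + v) = reflection u + reflection v.
  exact/val_inj/funext.
(* Decay of [T^-n y'] amounts to decay of [T^n] on the reflection of [y']. *)
have [y' vy yy'] : exists2 y', vanishing (reflection y') & nnorm (y - y') < d / 2.
  apply: (@delta_span_dense R s X (fun y => vanishing (reflection y)) _ _ d2).
  - by rewrite refl0; exact: vanishing0.
  - by move=> u v vu vv; rewrite reflD; exact: vanishingD.
  - by move=> a j; rewrite reflection_delta; exact: vanishing_delta.
have [k xk] := vx _ d2; have [l yl] := vy _ e2.
exists (maxn k l) => n kn; apply/return_setP; exists (x' + backward n y').
  apply: eU; rewrite (splitr e); apply: (nnormB_ltD xx').
  have E : nnorm (backward n y') = nnorm (iter n T (reflection y')).
    exact: nnorm_reflection.
  by apply: (eq_ind_r (fun r => r < _) _ E); apply: yl; lia.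
rewrite iter_height_shiftD backwardK addrC.
apply: dW; rewrite (splitr d); apply: (nnormB_ltD yy').
by apply: xk; lia.
Qed.

(** Open sets of the product are shrunk to boxes; the larger of the two thresholds serves both
    factors. *)
Lemma height_shift_mixing (F : set (set nat)) : furstenberg_family F ->
  (forall k : nat, F [set n | k%:Z < h n%:Z]) -> family_mixing F T.
Proof.
move=> [_ _ Fup] Fh U W; rewrite !openE => oU [[x x'] /oU] oUx oW [[y y'] /oW] oWy.
have [[U1 U2] [/= /nbhs_interior U1x /nbhs_interior U2x] U12] := oUx.
have [[W1 W2] [/= /nbhs_interior W1y /nbhs_interior W2y] W12] := oWy.
have [k kh] := height_shift_return (open_interior U1)
  (ex_intro _ x (nbhs_singleton U1x)) (open_interior W1)
  (ex_intro _ y (nbhs_singleton W1y)).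
have [l lh] := height_shift_return (open_interior U2)
  (ex_intro _ x' (nbhs_singleton U2x)) (open_interior W2)
  (ex_intro _ y' (nbhs_singleton W2y)).
apply: (Fup _ _ (Fh (maxn k l))) => n /= kn.
have /return_setP[z Uz Wz] := kh n ltac:(lia).
have /return_setP[z' Uz' Wz'] := lh n ltac:(lia).
have iterE m u : iter m (direct_sum T) u = (iter m T u.1, iter m T u.2).
  by elim: m => [|m IH]; [case: u|rewrite !iterS IH].
apply/return_setP; exists (z, z').
  by apply: U12; split; apply: interior_subset.
by rewrite iterE; apply: W12; split; apply: interior_subset.
Qed.

(** * Return times of the ball about [e_0] *)

Hypothesis h0 : h 0 = 0.

(** The radius exceeds [4 ^ (-1)], so perturbations of that size are allowed; being at most 1/2, it
    makes [|1 - a| < r] and [|b| < r] incompatible with [|a| <= |b|]. *)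
Definition delta_ball : set V := [set x | nnorm (delta s X 0 - x) < 2^-1].

Lemma delta_ball_center : delta_ball (delta s X 0).
Proof.
rewrite /delta_ball /= subrr.
by have := nnorm_delta X (0 : K) 0; rewrite scale0r modulus0 => ->; rewrite invr_gt0.
Qed.

Lemma height_shift_return_delta_ball n : 0 < h n%:Z ->
  return_set T delta_ball delta_ball n.
Proof.
(* Chosen so that [T^n] sends [t e_n] exactly to [e_0]. *)
move=> hn; pose t := ratio 0 n%:Z.
have small (x : V) j : x = ratio 0 j *: delta s X j -> 0 < h j -> nnorm x < 2^-1.
  move=> -> hj.
  have E : nnorm (ratio 0 j *: delta s X j) = 4 ^ (- h j).
    apply: etrans (nnorm_delta _ _ _) _.
    by rewrite modulus_of_real h0 sub0r ger0_norm// exprz_ge0.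
  apply: (eq_ind_r (fun r => r < _) _ E).
  (* [h] is integer-valued, so a positive height is at least 1. *)
  apply: (@le_lt_trans _ _ (4 ^ (-1))); first by rewrite ler_eXz2l ?ltr1n//; lia.
  by rewrite -invr_expz expr1z ltf_pV2 ?posrE// ltr_nat.
have ballD (x : V) : nnorm x < 2^-1 -> delta_ball (delta s X 0 + x).
  by rewrite /delta_ball /= opprD addNKr nnormN.
apply/return_setP; exists (delta s X 0 + t *: delta s X n%:Z).
  by apply/ballD/(small _ n%:Z).
rewrite iter_height_shiftD iter_height_shift_delta subrr ratioM; last by rewrite subrKA subrr.
(* What remains is [T^n e_0], a multiple of [e_(-n)], small because [h] is even. *)
rewrite scale1r addrC; apply/ballD/(small _ (- n%:Z)); last by rewrite hN.
by rewrite -[delta s X 0]scale1r iter_height_shift_delta mul1r sub0r.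
Qed.

Lemma height_shift_return_delta_ball_gt0 n :
  return_set T delta_ball delta_ball n -> n != 0%N -> 0 < h n%:Z.
Proof.
move=> /return_setP[x xW TxW] n0.
rewrite ltNge; apply/negP => hn.
have Tx0 : modulus (1 - ratio n%:Z 0 * x n%:Z : K) < 2^-1.
  apply: le_lt_trans TxW.
  have := space_norm_eval 0 (spaceP (delta s X 0 - iter n T x)).
  rewrite -[X in modulus X]/((0 == 0 :> int)%:R - iter n T x 0) iter_height_shift.
  by rewrite add0r.
have xn : modulus (x n%:Z : K) < 2^-1.
  apply: le_lt_trans xW.
  have := space_norm_eval n%:Z (spaceP (delta s X 0 - x)).
  have n0' : (n%:Z == 0) = false by exact: negPf.
  rewrite -[X in modulus X]/((n%:Z == 0)%:R - x n%:Z) n0' sub0r.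
  by rewrite modulusN.
(* With [r = 4 ^ h n <= 1], the triangle inequality gives
   [1 <= |1 - r x_n| + r |x_n| < 1/2 + 1/2]. *)
have := modulusD (1 - ratio n%:Z 0 * x n%:Z : K) (ratio n%:Z 0 * x n%:Z).
rewrite subrK modulus1 modulusM modulus_of_real.
rewrite ger0_norm ?exprz_ge0// h0 subr0 => tri.
have h1 : (4 : R) ^ h n%:Z <= 1.
  by rewrite -[leRHS](expr0z 4) ler_eXz2l// ltr1n.
have := ler_wpM2r (modulus_ge0 (x n%:Z : K)) h1; rewrite mul1r.
by move: Tx0; rewrite h0 subr0; lra.
Qed.

End height_shift.

Theorem lemma4p1 (R : realType) (s : scalars) (X : space_kind R)
    (F : set (set nat)) (A : set nat)
    (F_family : furstenberg_family F) (F_full : full_family F) :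
  tilde_family F A <->
  exists (w : weight R) (W : set (seq_space s X)),
    [/\ invertible (weighted_shift s X w),
        family_mixing F (weighted_shift s X w),
        open W, W !=set0 &
        return_set (weighted_shift s X w) W W = A `|` [set 0%N]].
Proof.
split=> [FA|[w [W [[S [_ TS _]] T_mixing oW W0 WA]]]]; last first.
  apply: (mixing_return_set_tilde F_family _ T_mixing F_full _ oW W0 WA).
    exact: weighted_shift_continuous.
  by move=> y; exists (S y).
have lip := height_lip A.
exists (height_weight R lip), (@delta_ball R s X); split.
- exact/height_shift_invertible/heightN.
- apply: height_shift_mixing => // [|k]; first exact: heightN.
  exact: tilde_family_depth F_family F_full FA.
- exact: open_nnorm_ball.
- by exists (delta s X 0); exact: delta_ball_center.
apply/seteqP; split=> n.
  have [->|n0] := eqVneq n 0%N; first by right.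
  move=> /(height_shift_return_delta_ball_gt0 (height0 A))/(_ n0) hn; left.
  apply: contrapT => An; move: hn.
  by rewrite /height absz_nat depth_eq0// => -[].
have [->|n0] := eqVneq n 0%N.
  move=> _; apply/return_setP; exists (delta s X 0); exact: delta_ball_center.
move=> [An|/= n00]; last by rewrite n00 eqxx in n0.
apply: height_shift_return_delta_ball; [exact: heightN|exact: height0|].
(* With [k = 0] the only point to test is [n] itself. *)
apply: ltn_depth => a na an; have -> : a = n by rewrite absz_nat in na an; lia.
by split=> //; apply/eqP.
Qed.
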